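(* There are infinitely many $n\in\mathbb N$ such that there exists a $2$-quasi-perfect Lee code over an $n$-dimensional Lee space.
   Context: An $n$-dimensional Lee space is $\mathbb Z_q^n$ (for an integer alphabet size $q\ge 2$, $\mathbb Z_q=\mathbb Z/q\mathbb Z$) with the Lee distance $d(v,w)=\sum_{j=1}^n \min\{|s| : s\in\mathbb Z,\ s\equiv v_j-w_j \pmod q\}$. A Lee code is a subset $\mathcal C\subseteq\mathbb Z_q^n$. The error correction of $\mathcal C$ is the greatest integer $t$ such that for every word $w\in\mathbb Z_q^n$ there is at most one $c\in\mathcal C$ with $d(w,c)\le t$; then $\mathcal C$ is called $t$-error correcting. The covering radius of $\mathcal C$ is the smallest integer $r$ such that for every word $w$ there is at least one $c\in\mathcal C$ with $d(w,c)\le r$; then $\mathcal C$ is called $r$-covering. A code is $t$-quasi-perfect if it is $t$-error correcting and $(t+1)$-covering. *)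

(* Defs.v *)
From HB Require Import structures.
From mathcomp Require Import all_boot all_order all_algebra.
From mathcomp Require Import classical_sets functions cardinality.
Set Implicit Arguments.
Unset Strict Implicit.
Unset Printing Implicit Defensive.
Import GRing.Theory.
Local Open Scope ring_scope.

(* k = |s| for some integer s in the residue class a, i.e. s = k or s = -k *)
Definition abs_residue (q : nat) (a : 'Z_q) : pred nat :=
  fun k => ((k%:Z)%:~R == a) || ((- k%:Z)%:~R == a).

Lemma abs_residue_ex (q : nat) (a : 'Z_q) : exists k, abs_residue a k.
Proof. by exists (a : nat); rewrite /abs_residue -pmulrn natr_Zp eqxx. Qed.

Definition lee_weight (q : nat) (a : 'Z_q) : nat := ex_minn (abs_residue_ex a).

(* 'Z_q is the ring of integers modulo q only for 1 < q; this hypothesis on the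
   alphabet size is required wherever the definitions below are used. *)
Definition lee_dist (q n : nat) (v w : 'rV['Z_q]_n) : nat :=
  (\sum_(j < n) lee_weight (v 0%R j - w 0%R j)%R)%N.

Definition packs (q n : nat) (C : {set 'rV['Z_q]_n}) (t : nat) : Prop :=
  forall w c1 c2 : 'rV['Z_q]_n, c1 \in C -> c2 \in C ->
    (lee_dist w c1 <= t)%N -> (lee_dist w c2 <= t)%N -> c1 = c2.

Definition covers (q n : nat) (C : {set 'rV['Z_q]_n}) (r : nat) : Prop :=
  forall w : 'rV['Z_q]_n, exists2 c, c \in C & (lee_dist w c <= r)%N.

(* The error correction is the greatest t, and the covering radius the least r,
   with the respective property. Natural numbers suffice: any negative t has
   the first property (as does 0), and no negative r has the second. *)
Definition error_correcting (q n : nat) (t : nat) (C : {set 'rV['Z_q]_n}) :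
    Prop :=
  packs C t /\ forall t' : nat, packs C t' -> (t' <= t)%N.

Definition covering (q n : nat) (r : nat) (C : {set 'rV['Z_q]_n}) : Prop :=
  covers C r /\ forall r' : nat, covers C r' -> (r <= r')%N.

Definition quasi_perfect (q n : nat) (t : nat) (C : {set 'rV['Z_q]_n}) : Prop :=
  error_correcting t C /\ covering t.+1 C.

(* Main.v *)
(** Let p = 3 (mod 4) be a prime modulo which 3 is not a square, and let H be
    the unit circle x^2 + y^2 = 1 in the plane over F_p, which is closed under
    rotations. Pick one point h_j from each pair {h, -h} of H; the code is the
    kernel of v |-> sum_j v_j h_j, so Lee balls of radius r correspond to sums
    of at most r points of H.
    Packing: a point of H is determined by its inner product with z <> 0 up to
    the reflection in z, so z = a + b has only one solution up to order; and
    if a + b had norm 1 or 3, then 2 det(a, b) would be a square root of 3.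
    Covering: for z <> 0 the norms of z - h and those of 1 + u, for h and u in
    H, both take more than p/2 values, so they share one; if z <> h, then
    z - h = r (1 + u) for a rotation r, and z = h + r + r u.
    Optimality: points of norm 3 need three summands, and there are more than
    p^2 words of weight 3. *)

Require Import Defs.
From HB Require Import structures.
From mathcomp Require Import all_boot all_order all_algebra all_field.
From mathcomp Require Import classical_sets functions cardinality.
From mathcomp Require Import zify ring.
Set Implicit Arguments.
Unset Strict Implicit.
Unset Printing Implicit Defensive.
Import GRing.Theory.
Local Open Scope ring_scope.

(* Provides the missing [finZmodType] structure on products. *)
HB.saturate prod.

(** * The unit circle in the plane over a finite field *)

Definition dot (F : fieldType) (z w : F * F) : F := z.1 * w.1 + z.2 * w.2.

Definition circle (F : finFieldType) : {set F * F} := [set z | dot z z == 1].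

Lemma circleP (F : finFieldType) (z : F * F) :
  reflect (dot z z = 1) (z \in circle F).
Proof. by rewrite inE; apply: eqP. Qed.

Lemma circleN (F : finFieldType) (z : F * F) :
  (- z \in circle F) = (z \in circle F).
Proof. by rewrite !inE /dot /= !mulrNN. Qed.

(** With [y != 0], the quotient [x / y] would be a square root of -1. *)
Lemma dot_self_eq0 (F : fieldType) (z : F * F) :
  (forall x : F, x ^+ 2 != -1) -> dot z z = 0 -> z = 0.
Proof.
case: z => x y irr; rewrite /dot /= => xy0.
have [y0 | yN0] := eqVneq y 0.
  move/eqP: xy0; rewrite y0 mulr0 addr0 mulf_eq0 orbb => /eqP -> //.
case/negP: (irr (x / y)); apply/eqP.
have -> : (x / y) ^+ 2 = (x * x + y * y) / (y * y) - 1 by field.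
by rewrite xy0 mul0r sub0r.
Qed.

(** In characteristic 2, 1 is a square root of -1. *)
Lemma two_neq0 (F : fieldType) : (forall x : F, x ^+ 2 != -1) -> 2 != 0 :> F.
Proof.
move=> irr; apply: contraNneq (irr 1) => two0; apply/eqP.
by rewrite expr1n -[LHS](addrK 1) -[1 + 1]/(2%:R) two0 sub0r.
Qed.

(** The norm of [a + b] is 2 + 2 dot(a, b), and det(a, b)^2 + dot(a, b)^2 = 1. Norm 1 or 3 forces 2
    dot(a, b) = -1 or 1, so (2 det(a, b))^2 = 4 - 1 = 3. *)
Lemma dot_circle_neq (F : finFieldType) (a b : F * F) :
  (forall x : F, x ^+ 2 != 3) -> a \in circle F -> b \in circle F ->
  dot (a + b) (a + b) != 1 /\ dot (a + b) (a + b) != 3.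
Proof.
case: a b => [a1 a2] [b1 b2] irr /circleP; rewrite /dot /= => aC /circleP.
rewrite /dot /= => bC.
split; apply/eqP => abE; case/negP: (irr (2 * (a1 * b2 - a2 * b1))); apply/eqP.
  have dE : 2 * (a1 * b1 + a2 * b2) = -1.
    have -> : 2 * (a1 * b1 + a2 * b2) = (a1 + b1) * (a1 + b1)
      + (a2 + b2) * (a2 + b2) - (a1 * a1 + a2 * a2) - (b1 * b1 + b2 * b2).
      by ring.
    by rewrite abE aC bC; ring.
  have -> : (2 * (a1 * b2 - a2 * b1)) ^+ 2 =
    4 * ((a1 * a1 + a2 * a2) * (b1 * b1 + b2 * b2))
      - (2 * (a1 * b1 + a2 * b2)) ^+ 2 by ring.
  by rewrite dE aC bC; ring.
have dE : 2 * (a1 * b1 + a2 * b2) = 1.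
  have -> : 2 * (a1 * b1 + a2 * b2) = (a1 + b1) * (a1 + b1)
    + (a2 + b2) * (a2 + b2) - (a1 * a1 + a2 * a2) - (b1 * b1 + b2 * b2).
    by ring.
  by rewrite abE aC bC; ring.
have -> : (2 * (a1 * b2 - a2 * b1)) ^+ 2 =
  4 * ((a1 * a1 + a2 * a2) * (b1 * b1 + b2 * b2))
    - (2 * (a1 * b1 + a2 * b2)) ^+ 2 by ring.
by rewrite dE aC bC; ring.
Qed.

(** Twice the orthogonal projection of [a] onto [z], minus [a]: the reflection that fixes [z]. *)
Definition reflect_along (F : fieldType) (z a : F * F) : F * F :=
  (2 * dot z a / dot z z * z.1 - a.1, 2 * dot z a / dot z z * z.2 - a.2).

(** Equal inner products make [b - a] orthogonal to [z], and equal norms make it orthogonal to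
    [b + a]. If [b != a], then [a + b] is therefore a multiple of [z], namely twice the projection
    of [a]. *)
Lemma circle_line (F : finFieldType) (z a b : F * F) :
  (forall x : F, x ^+ 2 != -1) -> z != 0 ->
  a \in circle F -> b \in circle F -> dot z a = dot z b ->
  b = a \/ b = reflect_along z a.
Proof.
move=> irr zN0.
have zzN0 : dot z z != 0.
  by apply: contraNneq zN0 => /(dot_self_eq0 irr) ->.
case: z a b zzN0 {zN0} => [z1 z2] [a1 a2] [b1 b2].
rewrite /reflect_along /dot /= => zzN0 /circleP + /circleP; rewrite /dot /=.
move=> aC bC zab.
have uz : (b1 - a1) * z1 + (b2 - a2) * z2 = 0.
  apply/eqP; rewrite -(subr0 (_ + _)) -[X in _ - X](subrr (z1 * a1 + z2 * a2)).
  by rewrite [X in _ - (X - _)]zab; apply/eqP; ring.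
have uv : (b1 - a1) * (b1 + a1) + (b2 - a2) * (b2 + a2) = 0.
  transitivity ((b1 * b1 + b2 * b2) - (a1 * a1 + a2 * a2)); first by ring.
  by rewrite aC bC subrr.
have [ba | baN] := eqVneq (b1, b2) (a1, a2); [by left | right].
have det0 : z1 * (b2 + a2) - z2 * (b1 + a1) = 0.
  apply/eqP; apply: contraNT baN => dN0.
  have /eqP e1 : (b1 - a1) * (z1 * (b2 + a2) - z2 * (b1 + a1)) = 0.
    transitivity (((b1 - a1) * z1 + (b2 - a2) * z2) * (b2 + a2) -
      ((b1 - a1) * (b1 + a1) + (b2 - a2) * (b2 + a2)) * z2); first by ring.
    by rewrite uz uv; ring.
  have /eqP e2 : (b2 - a2) * (z1 * (b2 + a2) - z2 * (b1 + a1)) = 0.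
    transitivity (((b1 - a1) * (b1 + a1) + (b2 - a2) * (b2 + a2)) * z1 -
      ((b1 - a1) * z1 + (b2 - a2) * z2) * (b1 + a1)); first by ring.
    by rewrite uz uv; ring.
  move: e1 e2; rewrite !mulf_eq0 (negPf dN0) !orbF !subr_eq0.
  by move=> /eqP -> /eqP ->.
have dE : 2 * (z1 * a1 + z2 * a2) = z1 * (b1 + a1) + z2 * (b2 + a2).
  transitivity ((z1 * a1 + z2 * a2) + (z1 * a1 + z2 * a2)); first by ring.
  by rewrite {1}zab; ring.
rewrite dE; congr pair; apply/eqP; rewrite eq_sym subr_eq; apply/eqP.
  rewrite mulrAC; apply: (mulIf zzN0); rewrite divfK //.
  transitivity ((b1 + a1) * (z1 * z1 + z2 * z2) +
    z2 * (z1 * (b2 + a2) - z2 * (b1 + a1))); first by ring.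
  by rewrite det0; ring.
rewrite mulrAC; apply: (mulIf zzN0); rewrite divfK //.
transitivity ((b2 + a2) * (z1 * z1 + z2 * z2) -
  z1 * (z1 * (b2 + a2) - z2 * (b1 + a1))); first by ring.
by rewrite det0; ring.
Qed.

(** As [a] and [b] have equal norms, [a + b] has inner product with [a] equal to half its own norm;
    the same holds for [c]. The reflection fixing [a + b] swaps [a] and [b]. *)
Lemma circle_sum_eq (F : finFieldType) (a b c d : F * F) :
  (forall x : F, x ^+ 2 != -1) -> a \in circle F -> b \in circle F ->
  c \in circle F -> d \in circle F -> a + b = c + d ->
  [\/ a + b = 0, c = a /\ d = b | c = b /\ d = a].
Proof.
move=> irr aC bC cC dC abcd.
have [ab0 | abN0] := eqVneq (a + b) 0; first by constructor 1.
have dotE u v : u \in circle F -> v \in circle F ->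
    2 * dot (u + v) u = dot (u + v) (u + v).
  case: u v => [u1 u2] [v1 v2] /circleP + /circleP; rewrite /dot /= => uC vC.
  transitivity ((u1 + v1) * (u1 + v1) + (u2 + v2) * (u2 + v2)
     + (u1 * u1 + u2 * u2) - (v1 * v1 + v2 * v2)); first by ring.
  by rewrite uC vC addrK.
have two := two_neq0 irr.
have dab : dot (a + b) a = dot (a + b) c.
  by apply: (mulfI two); rewrite dotE // abcd dotE.
have [ca | cE] := circle_line irr abN0 aC cC dab.
  by constructor 2; split=> //; move: abcd; rewrite ca => /addrI.
have zzN0 : dot (a + b) (a + b) != 0.
  by apply: contraNneq abN0 => /(dot_self_eq0 irr) ->.
have cb : c = b.
  rewrite cE /reflect_along dotE // divff // !mul1r.
  by case: (a) (b) => [a1 a2] [b1 b2] /=; congr pair; ring.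
by constructor 3; split=> //; move: abcd; rewrite cb addrC => /addrI.
Qed.

(** * Counting arguments and sums of three circle points *)

Lemma leq_card_imset_fibre2 (T U : finType) (f : T -> U) (g : T -> T)
    (A : {set T}) :
  {in A &, forall x y, f x = f y -> y = x \/ y = g x} ->
  (#|A| <= 2 * #|f @: A|)%N.
Proof.
move=> fibre.
rewrite -sum1_card (partition_big_imset f) mulnC -sum_nat_const /=.
apply: leq_sum => _ /imsetP[x xA ->].
rewrite sum1_card; apply: (@leq_trans #|[set x; g x]|).
  apply/subset_leq_card/fintype.subsetP => y /andP[yA /eqP fyx].
  have [->|->] := fibre _ _ xA yA (esym fyx); first exact: set21.
  exact: set22.
by rewrite cards2; case: eqP.
Qed.

(** Odd cardinality turns each bound into strictly more than half of [T], so the sets cannot be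
    disjoint. *)
Lemma pigeonhole_half (T : finType) (A B : {set T}) :
  odd #|T| -> (#|T| <= 2 * #|A|)%N -> (#|T| <= 2 * #|B|)%N ->
  exists2 x, x \in A & x \in B.
Proof.
move=> oddT hA hB.
have: A :&: B != finset.set0.
  apply/eqP => AB0.
  have := max_card (mem (A :|: B)); rewrite cardsU AB0 cards0 => AB.
  by lia.
by case/set0Pn => x /setIP[xA xB]; exists x.
Qed.

(** Squaring is at most two-to-one, so the squares and the values [k] minus a square each fill at
    least half of [F]. *)
Lemma exists_sum_two_squares (F : finFieldType) (k : F) :
  odd #|F| -> exists z : F * F, dot z z = k.
Proof.
move=> oddF.
have sq : (#|F| <= 2 * #|[set x ^+ 2 | x in [set: F]]|)%N.
  rewrite -[leqLHS]cardsT.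
  apply: (@leq_card_imset_fibre2 _ _ _ (@GRing.opp F)) => x y _ _ /esym/eqP.
  by rewrite eqf_sqr => /orP[/eqP|/eqP]; [left | right].
have sq' : (#|F| <= 2 * #|[set (k - x)%R | x in [set x ^+ 2 | x in [set: F]]]|)%N.
  by rewrite card_imset // => x y /addrI /oppr_inj.
have [_ /imsetP[x _ ->] /imsetP[_ /imsetP[y _ ->] xy]] :=
  pigeonhole_half oddF sq sq'.
by exists (x, y); rewrite /dot /= -!expr2 xy subrK.
Qed.

(** The rational parametrization by slope is injective, as t = y / (1 + x). Its denominators are
    nonzero because -1 is not a square. *)
Lemma leq_card_circle (F : finFieldType) :
  (forall x : F, x ^+ 2 != -1) -> (#|F| <= #|circle F|)%N.
Proof.
move=> irr.
have dN0 t : 1 + t ^+ 2 != 0 :> F by rewrite addrC addr_eq0.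
have two := two_neq0 irr.
pose f (t : F) := ((1 - t ^+ 2) / (1 + t ^+ 2), 2 * t / (1 + t ^+ 2)).
have finj : injective f.
  have fK t : (f t).2 / (1 + (f t).1) = t.
    rewrite /f /=.
    have -> : 1 + (1 - t ^+ 2) / (1 + t ^+ 2) = 2 / (1 + t ^+ 2).
      by field.
    by field; rewrite two dN0.
  by move=> s t st; rewrite -(fK s) st fK.
rewrite -cardsT -(card_imset _ finj); apply/subset_leq_card/fintype.subsetP.
move=> _ /imsetP[t _ ->]; apply/circleP; rewrite /dot /f /=.
by field.
Qed.

Lemma leq_card_dot_circle (F : finFieldType) (z : F * F) :
  (forall x : F, x ^+ 2 != -1) -> z != 0 ->
  (#|F| <= 2 * #|dot z @: circle F|)%N.
Proof.
move=> irr zN0; apply: (leq_trans (leq_card_circle irr)).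
apply: (@leq_card_imset_fibre2 _ _ _ (reflect_along z)) => a b aC bC.
exact: circle_line.
Qed.

Lemma circle_covering (F : finFieldType) (z : F * F) :
  odd #|F| -> (forall x : F, x ^+ 2 != -1) ->
  exists s : seq (F * F),
    [/\ (size s <= 3)%N, all [in circle F] s & \sum_(h <- s) h = z].
Proof.
move=> oddF irr; have [-> | zN0] := eqVneq z 0; first by
  exists [::]; rewrite big_nil.
have two := two_neq0 irr.
pose e : F * F := (1, 0).
have eN0 : e != 0 by rewrite -pair_eqE /= oner_eq0.
(* [A] holds the norms of [z - h], and [B] those of [e + u], for [h] and [u] on the circle. *)
pose A := [set dot z z + 1 - 2 * x | x in dot z @: circle F].
pose B := [set 2 + 2 * x | x in dot e @: circle F].
have Ahalf : (#|F| <= 2 * #|A|)%N.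
  rewrite card_imset; first exact: leq_card_dot_circle.
  by move=> x y /addrI /oppr_inj /(mulfI two).
have Bhalf : (#|F| <= 2 * #|B|)%N.
  rewrite card_imset; first exact: leq_card_dot_circle.
  by move=> x y /addrI /(mulfI two).
have [_ /imsetP[_ /imsetP[h hC ->] ->]] := pigeonhole_half oddF Ahalf Bhalf.
case/imsetP => _ /imsetP[u uC ->] norm_eq.
have {norm_eq} : dot (z - h) (z - h) = dot (e + u) (e + u).
  move/circleP: hC norm_eq => hC; move/circleP: uC => uC.
  have -> : dot (z - h) (z - h) = dot z z + dot h h - 2 * dot z h.
    by rewrite /dot /=; ring.
  have -> : dot (e + u) (e + u) = 1 + dot u u + 2 * dot e u.
    by rewrite /dot /=; ring.
  by rewrite hC uC => ->.
have [-> | zhN0] := eqVneq z h.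
  by exists [:: h]; rewrite big_seq1 /= hC.
have nN0 : dot (z - h) (z - h) != 0.
  by apply: contraNneq zhN0 => /(dot_self_eq0 irr) /eqP; rewrite subr_eq0.
have [[w1 w2] wE] : exists w, w = z - h by exists (z - h).
rewrite -wE in nN0 *; move=> norm_eq.
case: u uC norm_eq => [u1 u2] uC; rewrite /dot /= !add0r => norm_eq.
rewrite /dot /= in nN0; move: nN0; rewrite norm_eq => nN0.
(* Reading points as complex numbers, [r] is (z - h) / (e + u), of norm 1 because the norms agree;
   [ru] below is the product of [r] and [u]. *)
pose r : F * F := ((w1 * (1 + u1) + w2 * u2) /
                     ((1 + u1) * (1 + u1) + u2 * u2),
                   (w2 * (1 + u1) - w1 * u2) /
                     ((1 + u1) * (1 + u1) + u2 * u2)).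
have rC : dot r r = 1.
  rewrite /dot /=.
  transitivity ((w1 * w1 + w2 * w2) / ((1 + u1) * (1 + u1) + u2 * u2)).
    by field.
  by rewrite norm_eq divff.
pose ru : F * F := (r.1 * u1 - r.2 * u2, r.1 * u2 + r.2 * u1).
have ruC : dot ru ru = 1.
  move/circleP: uC; rewrite /dot /= => uC.
  transitivity (dot r r * (u1 * u1 + u2 * u2)); first by rewrite /dot /ru /=; ring.
  by rewrite rC uC mulr1.
exists [:: h; r; ru]; split=> //=; first by rewrite hC !inE rC ruC !eqxx.
rewrite !big_cons big_nil addr0.
have -> : r + ru = (w1, w2).
  by rewrite /ru /r; congr pair => /=; field.
by rewrite wE addrC subrK.
Qed.

(** * Lee balls as sums of signed unit words, and kernel codes *)

Lemma lee_weight_repr (q : nat) (a : 'Z_q) :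
  exists2 x : int, a = x%:~R & lee_weight a = `|x|%N.
Proof.
rewrite /lee_weight; case: ex_minnP => k /orP[] /eqP ka _.
  by exists k%:Z; rewrite // absz_nat.
by exists (- k%:Z); rewrite // abszN absz_nat.
Qed.

Lemma lee_weight_le (q : nat) (x : int) :
  (lee_weight (x%:~R : 'Z_q) <= `|x|)%N.
Proof.
rewrite /lee_weight; case: ex_minnP => k _; apply.
by rewrite /abs_residue; case: (intP x) => [|n|n]; rewrite ?abszN ?eqxx ?orbT.
Qed.

Lemma lee_weightD (q : nat) (a b : 'Z_q) :
  (lee_weight (a + b)%R <= lee_weight a + lee_weight b)%N.
Proof.
have [x -> ->] := lee_weight_repr a; have [y -> ->] := lee_weight_repr b.
by rewrite -intrD (leq_trans (lee_weight_le q _)) //; lia.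
Qed.

Lemma lee_weight0 (q : nat) : lee_weight (0 : 'Z_q) = 0%N.
Proof. by apply/eqP; rewrite -leqn0 (lee_weight_le q 0). Qed.

(** Indexing by ['I_n * bool] lets one list be read both as unit words and as their images under a
    map. *)
Definition signed (n : nat) (V : zmodType) (h : 'I_n -> V)
  (i : 'I_n * bool) : V := if i.2 then - h i.1 else h i.1.

Definition unit_word (q n : nat) (j : 'I_n) : 'rV['Z_q]_n := delta_mx 0 j.

(** Each signed unit word adds at most 1 to the distance. With the converse [lee_dist_decomp], this
    describes the Lee ball around [c]. *)
Lemma lee_dist_sum (q n : nat) (c : 'rV['Z_q]_n) (s : seq ('I_n * bool)) :
  (lee_dist (c + \sum_(i <- s) signed (@unit_word q n) i)%R c <= size s)%N.
Proof.
have distE (v : 'rV['Z_q]_n) :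
    lee_dist (c + v) c = (\sum_(j < n) lee_weight (v 0%R j))%N.
  by apply: eq_bigr => j _; rewrite !mxE addrAC subrr add0r.
elim: s => [|[i b] s IHs].
  by rewrite big_nil distE big1 // => j _; rewrite mxE lee_weight0.
move: IHs; rewrite !distE big_cons -[size (_ :: _)]add1n => IHs.
set u := signed _ _; set v := \sum_(k <- s) _ in IHs *.
apply: (@leq_trans
  (\sum_(j < n) (lee_weight (u 0%R j) + lee_weight (v 0%R j)))).
  by apply: leq_sum => j _; rewrite mxE lee_weightD.
rewrite big_split leq_add //= {}/u {v IHs}.
rewrite (bigD1 i) //= big1 ?addn0 => [|j ji].
  case: b; rewrite /signed !mxE !eqxx; last exact: (lee_weight_le q 1).
  exact: (lee_weight_le q (-1)).
by case: b; rewrite /signed !mxE (negPf ji) /= ?oppr0 lee_weight0.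
Qed.

Lemma lee_dist_decomp (q n : nat) (w c : 'rV['Z_q]_n) :
  exists2 s : seq ('I_n * bool), size s = lee_dist w c &
    w = c + \sum_(i <- s) signed (@unit_word q n) i.
Proof.
have /fin_all_exists2[x xE wt] := fun j : 'I_n =>
  lee_weight_repr (w 0 j - c 0 j).
(* Coordinate [j] contributes [|x j|] copies of its unit word, signed like the shortest
   representative [x j] of the difference. *)
exists (flatten [seq nseq `|x j|%N (j, x j < 0) | j <- enum 'I_n]).
  rewrite size_flatten /shape -map_comp sumnE big_map enumT.
  by apply: eq_bigr => j _; rewrite /= size_nseq wt.
rewrite big_flatten big_map enumT -[LHS](subrKC c); congr (c + _).
rewrite [LHS]row_sum_delta; apply: eq_bigr => j _.
rewrite !mxE xE big_nseq iter_addr_0 /signed scaler_int /=.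
by case: (x j) => k; rewrite ?mulNrn.
Qed.

(** The hypotheses yield in turn 2-packing, 3-covering, no 2-covering and no 3-packing; the last by
    pigeonhole on the ['C(n, 3)] indicator words of 3-sets. *)
Lemma quasi_perfect_kernel (q n : nat) (V : finZmodType)
    (f : {additive 'rV['Z_q]_n -> V}) :
  let e := signed (@unit_word q n) in
  let g := signed (fun j => f (unit_word q j)) in
  (forall s t : seq ('I_n * bool), (size s <= 2)%N -> (size t <= 2)%N ->
    \sum_(i <- s) g i = \sum_(i <- t) g i ->
    \sum_(i <- s) e i = \sum_(i <- t) e i) ->
  (forall z, exists2 s : seq ('I_n * bool), (size s <= 3)%N &
    \sum_(i <- s) g i = z) ->
  (exists z, forall s : seq ('I_n * bool), (size s <= 2)%N ->
    \sum_(i <- s) g i != z) ->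
  (#|V| < 'C(n, 3))%N ->
  quasi_perfect 2 [set v | f v == 0].
Proof.
move=> e g inj2 cov3 [z zN] cardV.
have fsum s : f (\sum_(i <- s) e i) = \sum_(i <- s) g i.
  rewrite raddf_sum; apply: eq_bigr => -[j b] _.
  by case: b; rewrite /e /g /signed //= raddfN.
split; split.
- move=> w c1 c2; rewrite !inE => /eqP fc1 /eqP fc2.
  have [s1 <- w1] := lee_dist_decomp w c1; have [s2 <- w2] := lee_dist_decomp w c2.
  move=> s1_le s2_le; apply: (addIr (\sum_(i <- s1) e i)); rewrite -w1 {1}w2.
  congr (_ + _); apply: inj2 => //.
  by rewrite -!fsum -[LHS]add0r -fc2 -raddfD -w2 w1 raddfD fc1 add0r.
- move=> t packs_t; rewrite leqNgt; apply/negP => t_gt2.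
  pose chi (A : {set 'I_n}) := \sum_(i <- [seq (j, false) | j <- enum A]) e i.
  have chiE A j : chi A 0 j = (j \in A)%:R.
    rewrite /chi big_map big_enum /= summxE.
    have [jA | jNA] := boolP (j \in A).
      rewrite (bigD1 j) //= big1 ?addr0 ?mxE ?eqxx // => k /andP[_ kj].
      by rewrite mxE eq_sym (negPf kj) andbF.
    rewrite big1 // => k kA; rewrite mxE eqxx; case: eqP => // jk.
    by rewrite jk kA in jNA.
  have chi_dist (c : 'rV['Z_q]_n) (A : {set 'I_n}) :
      #|A| = 3%N -> (lee_dist (c + chi A)%R c <= t)%N.
    move=> cA; apply: leq_trans (lee_dist_sum _ _) _.
    by rewrite size_map -cardE cA.
  have chi_inj : {in [set A : {set 'I_n} | #|A| == 3] &,
      injective (fun A => f (chi A))}.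
    move=> A B; rewrite !inE => /eqP cA /eqP cB fAB.
    (* The codewords 0 and [chi A - chi B] both lie within distance [t] of [chi A]. *)
    have : 0 = chi A - chi B.
      apply: (packs_t (chi A)); rewrite ?inE ?raddfB ?fAB ?subrr ?raddf0 //.
        by have := chi_dist 0 A cA; rewrite add0r.
      by have := chi_dist (chi A - chi B) B cB; rewrite subrK.
    move=> /rowP AB; apply/setP => j; have := AB j; rewrite !mxE !chiE.
    by case: (j \in A) (j \in B) => [] [] //= /esym/eqP;
      rewrite ?sub0r ?subr0 ?oppr_eq0 ?oner_eq0.
  move: cardV; rewrite -[X in 'C(X, 3)]card_ord -card_draws.
  by rewrite -(card_in_imset chi_inj) ltnNge max_card.
- move=> w; have [s s_le fs] := cov3 (f w).
  exists (w - \sum_(i <- s) e i).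
    by rewrite inE raddfB fsum fs subrr.
  by rewrite -{1}[w](subrK (\sum_(i <- s) e i)) (leq_trans (lee_dist_sum _ _)).
- move=> r covers_r; rewrite leqNgt; apply/negP => r_lt3.
  (* Lift [z] to a word: a codeword within distance 2 of it would make [z] a sum of at most two
     signed values. *)
  have [s _ fs] := cov3 z.
  have [c] := covers_r (\sum_(i <- s) e i); rewrite inE => /eqP fc.
  have [s' <- sE] := lee_dist_decomp (\sum_(i <- s) e i) c => s'_le.
  have /eqP[] := zN s' (leq_trans s'_le r_lt3).
  by rewrite -fsum -[LHS]add0r -fc -raddfD -sE fsum.
Qed.

(** * The circle code and its syndrome map *)

Lemma half_system (V : finZmodType) (H : {set V}) :
  {in H, forall h, - h \in H} -> {in H, forall h, h != - h} ->
  exists n, exists h : 'I_n -> V,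
    [/\ injective (signed h), forall i, signed h i \in H &
      {in H, forall x, exists i, signed h i = x}].
Proof.
move=> HN HnoN.
(* The order of enumeration picks one element from each pair {h, -h}. *)
pose P := [set h in H | (enum_rank h < enum_rank (- h))%N].
exists #|P|, enum_val; split.
- have PN x y : x \in P -> y \in P -> x != - y.
    rewrite !inE => /andP[_ x_lt] /andP[_ y_lt]; apply/eqP => xy.
    by move: x_lt; rewrite xy opprK ltnNge ltnW.
  move=> [i b] [j c]; rewrite /signed /=.
  case: b c => [] [].
  + by move=> /oppr_inj /enum_val_inj ->.
  + by move=> /esym/eqP; rewrite (negPf (PN _ _ (enum_valP j) (enum_valP i))).
  + by move=> /eqP; rewrite (negPf (PN _ _ (enum_valP i) (enum_valP j))).
  + by move=> /enum_val_inj ->.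
- move=> [i b]; have := enum_valP i; rewrite inE => /andP[iH _].
  by case: b; rewrite /signed //= HN.
move=> x xH.
have [x_lt | x_ge] := ltnP (enum_rank x) (enum_rank (- x)).
  have xP : x \in P by rewrite inE xH.
  by exists (enum_rank_in xP x, false); rewrite /signed /= enum_rankK_in.
have xP : - x \in P.
  rewrite inE HN // opprK ltn_neqAle x_ge andbT /=.
  apply: contra (HnoN x xH) => /eqP/val_inj/enum_rank_inj xx.
  by apply/eqP.
by exists (enum_rank_in xP (- x), true); rewrite /signed /= enum_rankK_in ?opprK.
Qed.

Definition syndrome (F : fieldType) (n : nat) (h : 'I_n -> F * F)
  (v : 'rV[F]_n) : F * F :=
  (\sum_j v 0 j * (h j).1, \sum_j v 0 j * (h j).2).

Lemma syndrome_is_zmod_morphism (F : fieldType) (n : nat) (h : 'I_n -> F * F) :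
  zmod_morphism (syndrome h).
Proof.
move=> u v; rewrite /syndrome; congr pair; rewrite -sumrB.
  by apply: eq_bigr => j _; rewrite !mxE mulrBl.
by apply: eq_bigr => j _; rewrite !mxE mulrBl.
Qed.

HB.instance Definition _ (F : fieldType) (n : nat) (h : 'I_n -> F * F) :=
  GRing.isZmodMorphism.Build 'rV[F]_n (F * F)%type (syndrome h)
    (syndrome_is_zmod_morphism h).

Lemma syndrome_delta (F : fieldType) (n : nat) (h : 'I_n -> F * F) (j : 'I_n) :
  syndrome h (delta_mx 0 j) = h j.
Proof.
have sumE (x : 'I_n -> F) : \sum_k (delta_mx 0 j : 'rV[F]_n) 0 k * x k = x j.
  rewrite (bigD1 j) //= big1 ?addr0 => [|k kj]; first by rewrite mxE !eqxx mul1r.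
  by rewrite mxE (negPf kj) mul0r.
by rewrite /syndrome !sumE; case: (h j).
Qed.

Lemma signedN (n : nat) (V : zmodType) (h : 'I_n -> V) (i : 'I_n * bool) :
  signed h (i.1, ~~ i.2) = - signed h i.
Proof. by case: i => i []; rewrite /signed //= opprK. Qed.

(** Sums of at most two circle points agree only by cancellation or reordering, and both transfer to
    any other family [e], such as the unit words. *)
Lemma signed_sum_inj (F : finFieldType) (n : nat) (h : 'I_n -> F * F)
    (V : zmodType) (e : 'I_n -> V) (s t : seq ('I_n * bool)) :
  (forall x : F, x ^+ 2 != -1) -> (forall x : F, x ^+ 2 != 3) ->
  injective (signed h) -> (forall i, signed h i \in circle F) ->
  (size s <= 2)%N -> (size t <= 2)%N ->
  \sum_(i <- s) signed h i = \sum_(i <- t) signed h i ->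
  \sum_(i <- s) signed e i = \sum_(i <- t) signed e i.
Proof.
move=> irr1 irr3 h_inj hC.
have sum0 a b : signed h a + signed h b = 0 -> signed e a + signed e b = 0.
  move=> /eqP; rewrite addr_eq0 -signedN => /eqP/h_inj ->.
  by rewrite signedN addNr.
have circleN0 a : signed h a != 0.
  apply: contraTneq (hC a) => ->.
  by rewrite inE /dot /= mul0r addr0 eq_sym oner_eq0.
have circleN2 a b c : signed h a != signed h b + signed h c.
  have [+ _] := dot_circle_neq irr3 (hC b) (hC c).
  by apply: contraNneq => <-; move: (hC a); rewrite inE.
wlog st : s t / (size s <= size t)%N.
  move=> wl s2 t2 st; have [|] := leqP (size s) (size t); first by move/wl; apply.
  by move=> /ltnW ts; apply/esym/wl.
(* Lengths 0 and 1 clash since circle points are nonzero, and lengths 1 and 2 since no sum of two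
   has norm 1. *)
move: s t st => [|a [|b [|? ?]]] [|c [|d [|? ?]]] //= _ _ _;
  rewrite !big_cons ?big_nil ?addr0.
- by move/eqP; rewrite eq_sym (negPf (circleN0 c)).
- by move/esym/sum0 => ->.
- by move/h_inj => ->.
- by move/eqP; rewrite (negPf (circleN2 _ _ _)).
move=> abcd; have [ab0 | [/h_inj -> /h_inj ->] | [/h_inj -> /h_inj ->]] :=
    circle_sum_eq irr1 (hC a) (hC b) (hC c) (hC d) abcd.
- by rewrite (sum0 _ _ ab0) sum0 // -abcd.
- by [].
- by rewrite addrC.
Qed.

Lemma circle_neqN (F : finFieldType) (h : F * F) :
  2 != 0 :> F -> h \in circle F -> h != - h.
Proof.
case: h => x y two hC; apply: contraTneq hC => hN.
have xN : x = - x by have := congr1 fst hN.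
have yN : y = - y by have := congr1 snd hN.
have eq0 (u : F) : u = - u -> u = 0.
  move=> uN; apply: (mulfI two); rewrite mulr0 mulrDl mul1r {2}uN subrr //.
by rewrite (eq0 _ xN) (eq0 _ yN) inE /dot /= mul0r addr0 eq_sym oner_eq0.
Qed.

(** The binomial is of order p^3 / 48 at least, so the constant 100 leaves ample room. *)
Lemma sqr_lt_bin3 (p n : nat) : (100 < p)%N -> (p <= 2 * n)%N ->
  (p * p < 'C(n, 3))%N.
Proof.
move=> p_gt pn; have := bin_ffact n 3; rewrite !ffactnS ffactn0 -[3`!]/6%N.
by case: n pn => [|[|[|n]]] pn /=; nia.
Qed.

(* [pdiv p] stands for [p] because ['F_p] unfolds to ['Z_(pdiv p)]. *)
Lemma quasi_perfect_Fp (p : nat) : prime p -> (100 < p)%N ->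
  (forall x : 'F_p, x ^+ 2 != -1) -> (forall x : 'F_p, x ^+ 2 != 3) ->
  exists n, (p <= 2 * n)%N /\
    exists C : {set 'rV['Z_(pdiv p)]_n}, quasi_perfect 2 C.
Proof.
move=> p_pr p_gt irr1 irr3.
have two := two_neq0 irr1.
have oddF : odd #|'F_p|.
  by rewrite card_Fp //; case/even_prime: (p_pr) => // p2; rewrite p2 in p_gt.
have [||n [h [h_inj hC h_surj]]] := @half_system _ (circle 'F_p).
- by move=> a; rewrite circleN.
- by move=> a; apply: circle_neqN.
have pn : (p <= 2 * n)%N.
  rewrite -[leqLHS](card_Fp p_pr) (leq_trans (leq_card_circle irr1)) //.
  have sub : circle 'F_p \subset [set signed h i | i in [set: 'I_n * bool]].
    by apply/fintype.subsetP => a /h_surj[i <-]; apply: imset_f.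
  apply: leq_trans (subset_leq_card sub) _.
  by rewrite card_imset // cardsT card_prod card_ord card_bool mulnC.
exists n; split=> //; exists [set v | syndrome h v == 0].
have signedE : signed (fun j => syndrome h (delta_mx 0 j)) =1 signed h.
  by move=> [j b]; rewrite /signed syndrome_delta.
have sumE s : \sum_(i <- s) signed (fun j => syndrome h (delta_mx 0 j)) i =
    \sum_(i <- s) signed h i by apply: eq_bigr => i _; apply: signedE.
apply: quasi_perfect_kernel => [s t s2 t2|z||].
- rewrite !sumE; exact: signed_sum_inj.
- have [s [s3 sC <-]] := circle_covering z oddF irr1.
  have [t tE] : exists t, s = map (signed h) t.
    elim: s sC {s3} => [|a s IHs] /=; first by exists [::].
    by case/andP => /h_surj[i <-] /IHs[t ->]; exists (i :: t).
  exists t; first by rewrite -(size_map (signed h)) -tE.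
  by rewrite sumE tE big_map.
(* Sums of no, one or two circle points never have norm 3: the first two cases give norms 0 and 1,
   which are squares while 3 is not. *)
- have [z z3] := exists_sum_two_squares 3 oddF.
  exists z => s s2; rewrite sumE; apply: contra_eq_neq z3 => <-.
  case: s s2 => [|a [|b [|]]] //= _; rewrite ?big_cons ?big_nil ?addr0.
  + by rewrite /dot /= mul0r addr0; have := irr3 0; rewrite expr0n.
  + by move/circleP: (hC a) => ->; have := irr3 1; rewrite expr1n.
  + by case: (dot_circle_neq irr3 (hC a) (hC b)).
- by rewrite card_prod card_Fp // sqr_lt_bin3.
Qed.

(** * Large primes modulo which -1 and 3 are nonsquares *)

Lemma prime_divisor_mod4 (N : nat) : (N %% 4 = 3)%N ->
  exists p, [/\ prime p, p %| N & p %% 4 = 3]%N.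
Proof.
have [m] := ubnP N; elim: m N => // m IHm N N_lt N3.
have N_gt1 : (1 < N)%N by lia.
have pN := pdiv_dvd N; have p_pr := pdiv_prime N_gt1.
have [p3 | pN3] := eqVneq (pdiv N %% 4)%N 3%N; first by exists (pdiv N).
move: (pdiv_gt0 N) (prime_gt1 p_pr) => p_gt0 p_gt1.
have NE : N = (N %/ pdiv N * pdiv N)%N by rewrite divnK.
have [||q [q_pr qN q3]] := IHm (N %/ pdiv N)%N.
- nia.
(* The least prime factor is not 3 modulo 4, so the products modulo 4 force the cofactor to be 3
   modulo 4. *)
- move: NE N3 pN3; set a := (N %/ _)%N; set b := pdiv N => -> /=.
  rewrite -modnMm; move: (ltn_pmod a (isT : 0 < 4)%N) (ltn_pmod b (isT : 0 < 4)%N).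
  by case: (a %% 4)%N => [|[|[|[|]]]] //; case: (b %% 4)%N => [|[|[|[|]]]].
by exists q; split=> //; apply: dvdn_trans qN _; apply/dvdnP; exists (pdiv N);
  rewrite mulnC.
Qed.

(* A prime factor p = 3 mod 4 of 4 A^2 + 3 has -3 as a square and -1 as a
   nonsquare, so 3 is a nonsquare without appeal to quadratic reciprocity. *)
Lemma exists_prime_nonsquares (m : nat) : exists p, [/\ prime p, (m < p)%N,
  forall x : 'F_p, x ^+ 2 != -1 & forall x : 'F_p, x ^+ 2 != 3].
Proof.
(* A prime up to [m] other than 3 divides [A], so if it divided [4 * A ^ 2 + 3] it would divide 3.
   Skipping the multiples of 3 excludes 3 itself. *)
pose A := (\prod_(1 <= i < m.+1 | ~~ (3 %| i)) i)%N.
have A3 : ~~ (3 %| A)%N.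
  rewrite /A; elim/big_ind: _ => // x y hx hy.
  by rewrite Euclid_dvdM // negb_or hx.
have [|p [p_pr pN p3]] := @prime_divisor_mod4 (4 * A ^ 2 + 3); first by lia.
have pN3 : p != 3%N.
  apply: contraNneq A3 => pE; move: pN; rewrite pE dvdn_addl //.
  by rewrite Euclid_dvdM //= Euclid_dvdX // andbT.
have pF := pchar_Fp p_pr.
have irr1 (x : 'F_p) : x ^+ 2 != -1.
  apply/eqP => x2.
  (* Fermat gives x^p = x, while x^2 = -1 and p = 3 + 4k give x^p = x^3 = -x. *)
  have [k pk] : exists k, (p = 3 + 4 * k)%N by exists (p %/ 4)%N; lia.
  have : x ^+ (3 + 4 * k) = x by rewrite -pk -[RHS]expf_card card_Fp.
  rewrite exprD exprM (exprM x 2 2) exprS x2 sqrrN !expr1n mulr1 mulrN1 => xN.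
  have two : 2 != 0 :> 'F_p.
    by rewrite -(dvdn_pcharf pF); apply/negP => /dvdn_leq; lia.
  have x0 : x = 0.
    by apply: (mulfI two); rewrite mulr0 mulrDl mul1r -{2}xN subrr.
  by move/eqP: x2; rewrite x0 expr0n /= eq_sym oppr_eq0 oner_eq0.
exists p; split=> //.
- rewrite ltnNge; apply/negP => p_le.
  have pA : (p %| A)%N.
    rewrite /A (big_rem p) ?mem_index_iota ?prime_gt0 //=.
    by rewrite (@dvdn_prime2 3 p) // eq_sym pN3 dvdn_mulr.
  move: pN; rewrite dvdn_addr; first by rewrite dvdn_prime2 // (negPf pN3).
  by rewrite dvdn_mull // dvdn_exp.
move=> x; apply/eqP => x2.
have /eqP a2 : (4 * A ^ 2 + 3)%N%:R == 0 :> 'F_p by rewrite -(dvdn_pcharf pF).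
have xN0 : x != 0.
  apply: contraNneq pN3 => x0; move/eqP: x2.
  by rewrite x0 expr0n eq_sym /= -(dvdn_pcharf pF) dvdn_prime2.
(* Since (2A)^2 = -3 and x^2 = 3 modulo [p], the quotient squares to -1. *)
case/negP: (irr1 (2 * A%:R / x)); apply/eqP.
have -> : (2 * A%:R / x) ^+ 2 = ((4 * A ^ 2 + 3)%N%:R - 3) / x ^+ 2.
  by rewrite natrD natrM natrX; field.
by rewrite a2 sub0r mulNr x2 divff // -x2 expf_neq0.
Qed.

Theorem corollary2 :
  infinite_set [set n : nat | exists q : nat, (1 < q)%N /\
    exists C : {set 'rV['Z_q]_n}, quasi_perfect 2 C]%classic.
Proof.
move=> /finite_fsetP[X XE].
(* The dimension is at least p / 2, so this bound pushes it past every element of the supposedly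
   finite set. *)
have [p [p_pr p_gt irr1 irr3]] :=
  exists_prime_nonsquares (100 + 2 * \max_(n <- finmap.enum_fset X) n).
have [|n [pn [C CE]]] := quasi_perfect_Fp p_pr _ irr1 irr3; first by lia.
have nX : n \in finmap.enum_fset X.
  have <- : _ = (n \in finmap.enum_fset X : Prop) := congr1 (@^~ n) XE.
  by exists (pdiv p); split; [rewrite pdiv_id // prime_gt1 | exists C].
have : (n <= \max_(k <- finmap.enum_fset X) k)%N by apply: leq_bigmax_seq nX _.
by lia.
Qed.
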